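(* Let $L$ be a finite-dimensional nilpotent stem Lie algebra of nilpotency class $3$. Then \[\dim (L\wedge L)+\dim \mathrm{Im}\,\gamma_2' +\dim \mathrm{Im}\,\gamma_3' \leq \dim (L/L^2\wedge L/L^2)+ \dim (L^2/L^{3}\otimes_{mod} L^{(ab)})+\dim (L^3\otimes_{mod} L^{(ab)}).\]
   Context: Lie algebras are over a fixed field. $L^1=L$, $L^{i+1}=[L^i,L]$ is the lower central series (so $L^2=[L,L]$), $Z(L)$ is the center, and for any Lie algebra $H$, $H^{(ab)}=H/H^2$; thus $(L/Z(L))^{(ab)}\cong L/(L^2+Z(L))$. $L$ is called stem if $Z(L)\subseteq L^2$. The symbol $\otimes_{mod}$ denotes the usual tensor product of vector spaces (regarded as an abelian Lie algebra). The (non-abelian) tensor square $L\otimes L$ of a Lie algebra $L$ is the Lie algebra generated by symbols $m\otimes n$ ($m,n\in L$), subject to: bilinearity in $m,n$; $[m,m']\otimes n=m\otimes[m',n]-m'\otimes[m,n]$; $m\otimes[n,n']=[n',m]\otimes n-[n,m]\otimes n'$; $[m\otimes n,m'\otimes n']=-[n,m]\otimes[m',n']$. The exterior square $L\wedge L$ is the quotient of $L\otimes L$ by the ideal generated by all $x\otimes x$, $x\in L$. Write $\bar u=u+(L^2+Z(L))$ and $V=(L/Z(L))^{(ab)}$. The linear map $\gamma_2':V\otimes_{mod}V\otimes_{mod}V\to L^2/L^3\otimes_{mod}V$ is given by $\bar x\otimes\bar y\otimes\bar z\mapsto([x,y]+L^3)\otimes\bar z+([z,x]+L^3)\otimes\bar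 y+([y,z]+L^3)\otimes\bar x$. The linear map $\gamma_3':V\otimes_{mod}V\otimes_{mod}V\otimes_{mod}V\to L^3\otimes_{mod}V$ is given by $\bar x\otimes\bar y\otimes\bar z\otimes\bar w\mapsto[[x,y],z]\otimes\bar w+[w,[x,y]]\otimes\bar z+[[z,w],x]\otimes\bar y+[y,[z,w]]\otimes\bar x$. *)

(* Defs.v *)
From HB Require Import structures.
From mathcomp Require Import all_boot all_order all_algebra.
From mathcomp Require Import generic_quotient ring_quotient.
From mathcomp Require Import boolp.

Set Implicit Arguments.
Unset Strict Implicit.
Unset Printing Implicit Defensive.

Import GRing.Theory.
Local Open Scope ring_scope.
Local Open Scope quotient_scope.

HB.mixin Record isLieAlgebra (F : fieldType) L of GRing.Lmodule F L := {
  lie : L -> L -> L;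
  lie_linearl : forall y, linear (lie^~ y);
  lie_linearr : forall x, linear (lie x);
  liexx : forall x, lie x x = 0;
  lie_jacobi : forall x y z,
    lie x (lie y z) + lie y (lie z x) + lie z (lie x y) = 0 }.

#[short(type="lieType")]
HB.structure Definition LieAlgebra (F : fieldType) :=
  {L of isLieAlgebra F L & GRing.Lmodule F L}.

#[short(type="vectLieType")]
HB.structure Definition VectLieAlgebra (F : fieldType) :=
  {L of LieAlgebra F L & Vector F L}.

Notation "[ 'lie' x , y ]" := (lie x y)
  (at level 0, x at level 99, format "[ 'lie'  x ,  y ]") : ring_scope.

Section LieTheory.
Variables (F : fieldType) (L : lieType F).
Implicit Types x y z : L.

Lemma lieDl x y z : [lie x + y, z] = [lie x, z] + [lie y, z].
Proof. by have := lie_linearl z 1 x y; rewrite !scale1r. Qed.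
Lemma lieDr x y z : [lie z, x + y] = [lie z, x] + [lie z, y].
Proof. by have := lie_linearr z 1 x y; rewrite !scale1r. Qed.
HB.instance Definition _ x :=
  GRing.isLinear.Build F L L *:%R (lie x) (lie_linearr x).
Lemma lie0l z : [lie 0 : L, z] = 0.
Proof. by apply: (addIr [lie 0 : L, z]); rewrite -lieDl !add0r. Qed.
Lemma lie0r z : [lie z, 0 : L] = 0.
Proof. by apply: (addIr [lie z, 0 : L]); rewrite -lieDr !add0r. Qed.
Lemma lieZl a x z : [lie a *: x, z] = a *: [lie x, z].
Proof. by have := lie_linearl z a x 0; rewrite lie0l !addr0. Qed.
Lemma lieZr a x z : [lie z, a *: x] = a *: [lie z, x].
Proof. by have := lie_linearr z a x 0; rewrite lie0r !addr0. Qed.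
Lemma lieNl x z : [lie - x, z] = - [lie x, z].
Proof. by rewrite -scaleN1r lieZl scaleN1r. Qed.
Lemma lieNr x z : [lie z, - x] = - [lie z, x].
Proof. by rewrite -scaleN1r lieZr scaleN1r. Qed.
Lemma lieBl x y z : [lie x - y, z] = [lie x, z] - [lie y, z].
Proof. by rewrite lieDl lieNl. Qed.
Lemma lieBr x y z : [lie z, x - y] = [lie z, x] - [lie z, y].
Proof. by rewrite lieDr lieNr. Qed.
Lemma lieC x y : [lie x, y] = - [lie y, x].
Proof.
apply/eqP; rewrite -addr_eq0; apply/eqP.
by have := liexx (x + y); rewrite lieDl !lieDr !liexx add0r addr0.
Qed.

End LieTheory.

Record lieIdeal (F : fieldType) (L : lieType F) := LieIdeal {
  ideal_pred :> {pred L};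
  ideal_submod : submod_closed ideal_pred;
  ideal_lie : forall x y, y \in ideal_pred -> [lie x, y] \in ideal_pred }.

HB.instance Definition _ (F : fieldType) (L : lieType F) (I : lieIdeal L) :=
  GRing.isSubmodClosed.Build F L (ideal_pred I) (ideal_submod I).

Definition lquot (F : fieldType) (L : lieType F) (I : lieIdeal L) : Type :=
  {ideal_quot (ideal_pred I)}.

HB.instance Definition _ (F : fieldType) (L : lieType F) (I : lieIdeal L) :=
  GRing.Zmodule.on (lquot I).

Section Quotient.
Variables (F : fieldType) (L : lieType F) (I : lieIdeal L).

Definition lpi (x : L) : lquot I := \pi_({ideal_quot (ideal_pred I)}) x.
Definition lrepr (q : lquot I) : L := repr (q : {ideal_quot (ideal_pred I)}).

Lemma lreprK : cancel lrepr lpi.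
Proof. by move=> q; rewrite /lpi /lrepr reprK. Qed.

Lemma lpiP x y : (lpi x = lpi y) <-> (x - y \in ideal_pred I).
Proof.
rewrite (Quotient.idealrBE (ideal_pred I)); split=> [h|/eqP //].
by apply/eqP.
Qed.

Lemma lrepr_lpi x : lrepr (lpi x) - x \in ideal_pred I.
Proof. by apply/lpiP; rewrite lreprK. Qed.

Lemma lpiD x y : lpi (x + y) = lpi x + lpi y.
Proof. exact: (raddfD (\pi_({ideal_quot (ideal_pred I)}))). Qed.

Definition qscale (a : F) (q : lquot I) : lquot I := lpi (a *: lrepr q).
Definition qlie (p q : lquot I) : lquot I := lpi [lie lrepr p, lrepr q].

Lemma lpi_scale a x : qscale a (lpi x) = lpi (a *: x).
Proof. by apply/lpiP; rewrite -scalerBr rpredZ // lrepr_lpi. Qed.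

Lemma lpi_qlie x y : qlie (lpi x) (lpi y) = lpi [lie x, y].
Proof.
apply/lpiP; set x' := lrepr _; set y' := lrepr _.
have -> : [lie x', y'] - [lie x, y] = [lie x', y' - y] + [lie x' - x, y].
  by rewrite lieBr lieBl addrA subrK.
apply: rpredD; first by rewrite ideal_lie ?lrepr_lpi.
by rewrite lieC rpredN ideal_lie ?lrepr_lpi.
Qed.

Fact qscaleA a b q : qscale a (qscale b q) = qscale (a * b) q.
Proof. by rewrite -(lreprK q) !lpi_scale scalerA. Qed.
Fact qscale1 : left_id 1 qscale.
Proof. by move=> q; rewrite -(lreprK q) lpi_scale scale1r. Qed.
Fact qscaleDr : right_distributive qscale +%R.
Proof.
move=> a p q; rewrite -(lreprK q) -(lreprK p) -lpiD !lpi_scale.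
by rewrite scalerDr lpiD.
Qed.
Fact qscaleDl q : {morph qscale^~ q : a b / a + b}.
Proof. by move=> a b; rewrite -(lreprK q) !lpi_scale scalerDl lpiD. Qed.

HB.instance Definition _ := GRing.Zmodule_isLmodule.Build F (lquot I)
  qscaleA qscale1 qscaleDr qscaleDl.

Fact lpi_is_linear : linear lpi.
Proof. by move=> a x y; rewrite lpiD -lpi_scale. Qed.

HB.instance Definition _ :=
  GRing.isLinear.Build F L (lquot I) *:%R lpi lpi_is_linear.

Fact qlie_linearl q : linear (qlie^~ q).
Proof.
move=> a x y; rewrite -(lreprK q) -(lreprK x) -(lreprK y) -linearP !lpi_qlie.
by rewrite lie_linearl linearP.
Qed.
Fact qlie_linearr q : linear (qlie q).
Proof.
move=> a x y; rewrite -(lreprK q) -(lreprK x) -(lreprK y) -linearP !lpi_qlie.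
by rewrite lie_linearr linearP.
Qed.
Fact qliexx q : qlie q q = 0.
Proof. by rewrite -(lreprK q) lpi_qlie liexx linear0. Qed.
Fact qlie_jacobi p q r :
  qlie p (qlie q r) + qlie q (qlie r p) + qlie r (qlie p q) = 0.
Proof.
rewrite -(lreprK p) -(lreprK q) -(lreprK r) !lpi_qlie -!linearD.
by rewrite lie_jacobi linear0.
Qed.

HB.instance Definition _ := isLieAlgebra.Build F (lquot I)
  qlie_linearl qlie_linearr qliexx qlie_jacobi.

Lemma lpi_lie x y : lpi [lie x, y] = [lie lpi x, lpi y].
Proof. by rewrite -lpi_qlie. Qed.

End Quotient.

Section FinDimQuotient.
Variables (F : fieldType) (L : vectLieType F) (I : lieIdeal L).

Lemma ideal_vspace : exists U : {vspace L}, U =i ideal_pred I.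
Proof.
pose P n := `[< exists2 U : {vspace L},
  {subset U <= ideal_pred I} & \dim U = n >].
have exP : exists n, P n.
  exists 0%N; apply/asboolP; exists 0%VS; rewrite ?dimv0 //.
  by move=> x; rewrite memv0 => /eqP ->; apply: rpred0.
have leP n : P n -> (n <= \dim {:L})%N.
  by move=> /asboolP[U _ <-]; apply: dimvS; apply: subvf.
case: (ex_maxnP exP leP) => n /asboolP[U sUI dimU] maxn.
exists U => x; apply/idP/idP => [/sUI //|xI]; apply/negPn/negP => xU.
have : P (\dim (U + <[x]>)).
  apply/asboolP; exists (U + <[x]>)%VS => // _ /memv_addP[u uU [v vx ->]].
  by move: vx => /vlineP[k ->]; rewrite rpredD ?rpredZ //; apply: sUI.
move=> /maxn; rewrite -dimU => le_dim.
have /eqP eqU : (U == U + <[x]>)%VS by rewrite eqEdim addvSl.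
have := subvP (addvSr U <[x]>) x (memv_line x).
by rewrite -eqU (negPf xU).
Qed.

Lemma lquot_vect_axiom : {n : nat & Vector.axiom n (lquot I)}.
Proof.
have [U UI] := cid ideal_vspace.
pose f (q : lquot I) := vsproj (U^C)%VS (lrepr q - projv U (lrepr q)).
have fP x : f (lpi I x) = vsproj (U^C)%VS (x - projv U x).
  have /projv_id : lrepr (lpi I x) - x \in U by rewrite UI lrepr_lpi.
  rewrite linearB /= => eqx; congr vsproj; apply/eqP.
  by rewrite subr_eq -addrA [- _ + _]addrC eqx addrC subrK.
have f_lin : linear f.
  move=> a p q; rewrite -(lreprK p) -(lreprK q) -linearP !fP -linearP /=.
  congr vsproj; rewrite linearP /= scalerBr opprD addrACA.
  by [].
have fK : cancel f (fun w => lpi I (vsval w)).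
  move=> q; rewrite -[in RHS](lreprK q); apply/lpiP.
  by rewrite vsprojK ?memv_projC // addrAC subrr add0r rpredN -UI memv_proj.
have Kf : cancel (fun w => lpi I (vsval w)) f.
  move=> w; rewrite fP; set x := vsval w.
  have xC : x \in (U^C)%VS by apply: subvsP.
  suff -> : projv U x = 0 by rewrite subr0 vsvalK.
  by apply/eqP; rewrite -memv_ker lker_proj.
have [g g_lin g_bij] := subvs_vect_iso (U^C)%VS.
exists (\dim (U^C)); exists (g \o f); last exact: bij_comp g_bij (Bijective fK Kf).
by move=> a p q; rewrite /= f_lin g_lin.
Qed.

HB.instance Definition _ :=
  Lmodule_hasFinDim.Build F (lquot I) (projT2 lquot_vect_axiom).

End FinDimQuotient.

(* [freeLie F X], the free Lie algebra on X, is the quotient of formal Lie terms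
   by the least congruence containing the Lie algebra axioms. *)
Inductive lterm (F : Type) (X : Type) :=
  | LGen of X
  | LZero
  | LOpp of lterm F X
  | LAdd of lterm F X & lterm F X
  | LScale of F & lterm F X
  | LLie of lterm F X & lterm F X.
Arguments LGen {F X}.
Arguments LZero {F X}.

Inductive lcong (F : fieldType) (X : Type) : lterm F X -> lterm F X -> Prop :=
  | lc_refl s : lcong s s
  | lc_sym s t : lcong s t -> lcong t s
  | lc_trans s t u : lcong s t -> lcong t u -> lcong s u
  | lc_opp s t : lcong s t -> lcong (LOpp s) (LOpp t)
  | lc_add s s' t t' :
      lcong s s' -> lcong t t' -> lcong (LAdd s t) (LAdd s' t')
  | lc_scale a s t : lcong s t -> lcong (LScale a s) (LScale a t)
  | lc_lie s s' t t' :
      lcong s s' -> lcong t t' -> lcong (LLie s t) (LLie s' t')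
  | lc_addA s t u : lcong (LAdd s (LAdd t u)) (LAdd (LAdd s t) u)
  | lc_addC s t : lcong (LAdd s t) (LAdd t s)
  | lc_add0 s : lcong (LAdd LZero s) s
  | lc_addN s : lcong (LAdd (LOpp s) s) LZero
  | lc_scaleA a b s : lcong (LScale a (LScale b s)) (LScale (a * b) s)
  | lc_scale1 s : lcong (LScale 1 s) s
  | lc_scaleDr a s t :
      lcong (LScale a (LAdd s t)) (LAdd (LScale a s) (LScale a t))
  | lc_scaleDl a b s :
      lcong (LScale (a + b) s) (LAdd (LScale a s) (LScale b s))
  | lc_liePl a s s' t :
      lcong (LLie (LAdd (LScale a s) s') t)
            (LAdd (LScale a (LLie s t)) (LLie s' t))
  | lc_liePr a s t t' :
      lcong (LLie s (LAdd (LScale a t) t'))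
            (LAdd (LScale a (LLie s t)) (LLie s t'))
  | lc_liexx s : lcong (LLie s s) LZero
  | lc_jacobi s t u :
      lcong (LAdd (LAdd (LLie s (LLie t u)) (LLie t (LLie u s)))
                  (LLie u (LLie s t))) LZero.

Section FreeLie.
Variables (F : fieldType) (X : Type).

HB.instance Definition _ := gen_eqMixin (lterm F X).
HB.instance Definition _ := gen_choiceMixin (lterm F X).

Definition lcongb (s t : lterm F X) : bool := `[< lcong s t >].

Fact lcongb_equiv : equiv_class_of lcongb.
Proof.
split=> [s|s t|t s u].
- exact/asboolP/lc_refl.
- by apply/asboolP/asboolP; apply: lc_sym.
- by move=> /asboolP st /asboolP tu; apply/asboolP/(lc_trans st tu).
Qed.
Canonical lcongb_equiv_rel := EquivRelPack lcongb_equiv.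
Canonical lcongb_encModRel := defaultEncModRel lcongb.

Definition freeLie : Type := {eq_quot lcongb}.
HB.instance Definition _ := Choice.on freeLie.

Definition fl_pi (s : lterm F X) : freeLie := \pi_({eq_quot lcongb}) s.
Definition fl_repr (x : freeLie) : lterm F X := repr (x : {eq_quot lcongb}).

Lemma fl_reprK : cancel fl_repr fl_pi.
Proof. by move=> x; rewrite /fl_pi /fl_repr reprK. Qed.

Lemma fl_piP s t : fl_pi s = fl_pi t <-> lcong s t.
Proof.
rewrite /fl_pi; split=> [/eqP|st].
  by rewrite piE => /asboolP.
by apply/eqP; rewrite piE; apply/asboolP.
Qed.

Lemma fl_repr_pi s : lcong (fl_repr (fl_pi s)) s.
Proof. by apply/fl_piP; rewrite fl_reprK. Qed.

Definition fl_gen (x : X) : freeLie := fl_pi (LGen x).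
Definition fl_zero : freeLie := fl_pi LZero.
Definition fl_opp x := fl_pi (LOpp (fl_repr x)).
Definition fl_add x y := fl_pi (LAdd (fl_repr x) (fl_repr y)).
Definition fl_scale a x := fl_pi (LScale a (fl_repr x)).
Definition fl_lie x y := fl_pi (LLie (fl_repr x) (fl_repr y)).

Lemma fl_oppE s : fl_opp (fl_pi s) = fl_pi (LOpp s).
Proof. exact/fl_piP/lc_opp/fl_repr_pi. Qed.
Lemma fl_addE s t : fl_add (fl_pi s) (fl_pi t) = fl_pi (LAdd s t).
Proof. by apply/fl_piP/lc_add; apply: fl_repr_pi. Qed.
Lemma fl_scaleE a s : fl_scale a (fl_pi s) = fl_pi (LScale a s).
Proof. exact/fl_piP/lc_scale/fl_repr_pi. Qed.
Lemma fl_lieE s t : fl_lie (fl_pi s) (fl_pi t) = fl_pi (LLie s t).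
Proof. by apply/fl_piP/lc_lie; apply: fl_repr_pi. Qed.

Let flE := (fl_oppE, fl_addE, fl_scaleE, fl_lieE).

Fact fl_addA : associative fl_add.
Proof.
move=> x y z; rewrite -(fl_reprK x) -(fl_reprK y) -(fl_reprK z) !flE.
exact/fl_piP/lc_addA.
Qed.
Fact fl_addC : commutative fl_add.
Proof.
by move=> x y; rewrite -(fl_reprK x) -(fl_reprK y) !flE; apply/fl_piP/lc_addC.
Qed.
Fact fl_add0 : left_id fl_zero fl_add.
Proof. by move=> x; rewrite -(fl_reprK x) !flE; apply/fl_piP/lc_add0. Qed.
Fact fl_addN : left_inverse fl_zero fl_opp fl_add.
Proof. by move=> x; rewrite -(fl_reprK x) !flE; apply/fl_piP/lc_addN. Qed.

HB.instance Definition _ :=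
  GRing.isZmodule.Build freeLie fl_addA fl_addC fl_add0 fl_addN.

Fact fl_scaleA a b x : fl_scale a (fl_scale b x) = fl_scale (a * b) x.
Proof. by rewrite -(fl_reprK x) !flE; apply/fl_piP/lc_scaleA. Qed.
Fact fl_scale1 : left_id 1 fl_scale.
Proof. by move=> x; rewrite -(fl_reprK x) !flE; apply/fl_piP/lc_scale1. Qed.
Fact fl_scaleDr : right_distributive fl_scale +%R.
Proof.
move=> a x y; rewrite -(fl_reprK x) -(fl_reprK y) /GRing.add /= !flE.
exact/fl_piP/lc_scaleDr.
Qed.
Fact fl_scaleDl x : {morph fl_scale^~ x : a b / a + b}.
Proof.
move=> a b; rewrite -(fl_reprK x) [in RHS]/GRing.add /= !flE.
exact/fl_piP/lc_scaleDl.
Qed.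

HB.instance Definition _ := GRing.Zmodule_isLmodule.Build F freeLie
  fl_scaleA fl_scale1 fl_scaleDr fl_scaleDl.

Fact fl_liePl y : linear (fl_lie^~ y).
Proof.
move=> a x x'; rewrite -(fl_reprK x) -(fl_reprK y) -(fl_reprK x').
rewrite /GRing.add /GRing.scale /= !flE; exact/fl_piP/lc_liePl.
Qed.
Fact fl_liePr x : linear (fl_lie x).
Proof.
move=> a y y'; rewrite -(fl_reprK x) -(fl_reprK y) -(fl_reprK y').
rewrite /GRing.add /GRing.scale /= !flE; exact/fl_piP/lc_liePr.
Qed.
Fact fl_liexx x : fl_lie x x = 0.
Proof. by rewrite -(fl_reprK x) !flE; apply/fl_piP/lc_liexx. Qed.
Fact fl_jacobi x y z :
  fl_lie x (fl_lie y z) + fl_lie y (fl_lie z x) + fl_lie z (fl_lie x y) = 0.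
Proof.
rewrite -(fl_reprK x) -(fl_reprK y) -(fl_reprK z) /GRing.add /= !flE.
exact/fl_piP/lc_jacobi.
Qed.

HB.instance Definition _ := isLieAlgebra.Build F freeLie
  fl_liePl fl_liePr fl_liexx fl_jacobi.

End FreeLie.

Section IdealGen.
Variables (F : fieldType) (L : lieType F) (A : L -> Prop).

Definition ideal_gen_pred : {pred L} :=
  fun x => `[< forall I : lieIdeal L, (forall y, A y -> y \in I) -> x \in I >].

Fact ideal_gen_submod : submod_closed ideal_gen_pred.
Proof.
split; first by apply/asboolP => I _; apply: rpred0.
move=> a x y /asboolP xA /asboolP yA; apply/asboolP => I IA.
by rewrite rpredD ?rpredZ ?xA ?yA.
Qed.
Fact ideal_gen_lie x y : y \in ideal_gen_pred -> [lie x, y] \in ideal_gen_pred.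
Proof.
by move=> /asboolP yA; apply/asboolP => I IA; rewrite ideal_lie ?yA.
Qed.
Definition ideal_gen : lieIdeal L := LieIdeal ideal_gen_submod ideal_gen_lie.

End IdealGen.

Section TensorSquare.
Variables (F : fieldType) (L : lieType F).

Definition tsym (m n : L) : freeLie F (L * L) := fl_gen F (m, n).

(* [u] is a relator iff [u = 0] is one of the defining relations *)
Inductive tensorsq_rel : freeLie F (L * L) -> Prop :=
  | tr_linearl a m m' n :
      tensorsq_rel (tsym (a *: m + m') n - (a *: tsym m n + tsym m' n))
  | tr_linearr a m n n' :
      tensorsq_rel (tsym m (a *: n + n') - (a *: tsym m n + tsym m n'))
  | tr_liel m m' n :
      tensorsq_rel (tsym [lie m, m'] n
                    - (tsym m [lie m', n] - tsym m' [lie m, n]))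
  | tr_lier m n n' :
      tensorsq_rel (tsym m [lie n, n']
                    - (tsym [lie n', m] n - tsym [lie n, m] n'))
  | tr_lie m n m' n' :
      tensorsq_rel ([lie tsym m n, tsym m' n']
                    - - tsym [lie n, m] [lie m', n']).

Definition tensorsq : Type := lquot (ideal_gen tensorsq_rel).
HB.instance Definition _ := LieAlgebra.on tensorsq.

Definition tens (m n : L) : tensorsq := lpi (ideal_gen tensorsq_rel) (tsym m n).

Definition extsq_rel (u : tensorsq) : Prop := exists x, u = tens x x.

Definition extsq : Type := lquot (ideal_gen extsq_rel).
HB.instance Definition _ := LieAlgebra.on extsq.

Definition wedge (m n : L) : extsq := lpi (ideal_gen extsq_rel) (tens m n).

End TensorSquare.

Section FinDimLie.
Variables (F : fieldType) (L : vectLieType F).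
Implicit Types (x y : L) (U V : {vspace L}) (k c : nat).

Definition liev U V : {vspace L} :=
  <<[seq [lie x, y] | x <- vbasis U, y <- vbasis V]>>%VS.

Lemma mem_liev U V x y : x \in U -> y \in V -> [lie x, y] \in liev U V.
Proof.
move=> xU yV; rewrite (coord_vbasis xU) (coord_vbasis yV).
have lsum (I : Type) (r : seq I) (f : I -> L) z :
    [lie \sum_(i <- r) f i, z] = \sum_(i <- r) [lie f i, z].
  by apply: (big_morph (lie^~ z)) => [u v|]; rewrite ?lieDl ?lie0l.
have rsum (I : Type) (r : seq I) (f : I -> L) z :
    [lie z, \sum_(i <- r) f i] = \sum_(i <- r) [lie z, f i].
  by apply: (big_morph (lie z)) => [u v|]; rewrite ?lieDr ?lie0r.
rewrite lsum; apply: rpred_sum => i _; rewrite lieZl rsum rpredZ //.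
apply: rpred_sum => j _; rewrite lieZr rpredZ //; apply: memv_span.
by apply: allpairs_f; rewrite mem_nth // size_tuple.
Qed.

Lemma liev_sub U V (W : {vspace L}) :
  (forall x y, x \in U -> y \in V -> [lie x, y] \in W) -> (liev U V <= W)%VS.
Proof.
move=> h; apply/span_subvP => _ /allpairsP[[x y] /= [xU yV ->]].
by rewrite h ?vbasis_mem.
Qed.

(* [lcs k] is L^k in the convention L^1 = L; the value at 0 is irrelevant *)
Definition lcs k : {vspace L} := iter k.-1 (fun U => liev U fullv) fullv.

Lemma lcs_lie k x y : (0 < k)%N -> x \in lcs k -> [lie x, y] \in lcs k.+1.
Proof. by case: k => // k _ xk; rewrite /lcs iterS mem_liev ?memvf. Qed.

Lemma lcsS k : (lcs k.+1 <= lcs k)%VS.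
Proof.
case: k => [|k]; first exact: subvf.
elim: k => [|k IHk]; first exact: subvf.
by apply: liev_sub => x y xk _; apply: lcs_lie => //; apply: subvP xk.
Qed.

Fact vspace_submod U : submod_closed (mem U).
Proof. by split=> [|a x y xU yU]; [apply: mem0v | rewrite memvD ?memvZ]. Qed.

Fact lcs_ideal_subproof k x y : y \in mem (lcs k) -> [lie x, y] \in mem (lcs k).
Proof.
case: k => [|k] yk; first exact: memvf.
by rewrite lieC rpredN; apply: (subvP (lcsS k.+1)); apply: lcs_lie.
Qed.
Definition lcs_ideal k : lieIdeal L :=
  LieIdeal (vspace_submod (lcs k)) (@lcs_ideal_subproof k).

Definition center : {vspace L} :=
  (\bigcap_i lker (linfun (lie (tnth (vbasis {:L}) i))))%VS.

Lemma centerP x : reflect (forall y, [lie x, y] = 0) (x \in center).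
Proof.
have linE y z : linfun (lie y) z = [lie y, z] by rewrite lfunE.
apply: (iffP idP) => [xZ y|xZ].
  rewrite (coord_vbasis (memvf y)) (big_morph (lie x) (id1 := 0) (op1 := +%R)).
  - rewrite big1 // => i _; rewrite lieZr lieC -tnth_nth.
    have /subv_bigcapP/(_ i isT) : (<[x]> <= center)%VS by [].
    by rewrite -memvE memv_ker linE => /eqP ->; rewrite oppr0 scaler0.
  - by move=> u v; rewrite lieDr.
  - exact: lie0r.
by rewrite memvE; apply/subv_bigcapP => i _;
  rewrite -memvE memv_ker linE lieC xZ oppr0.
Qed.

Fact center_ideal_subproof x y :
  y \in mem center -> [lie x, y] \in mem center.
Proof. by move=> /centerP yZ; rewrite lieC yZ oppr0; apply: mem0v. Qed.
Definition center_ideal : lieIdeal L :=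
  LieIdeal (vspace_submod center) center_ideal_subproof.

Definition nilpotent_of_class c : Prop :=
  lcs c.+1 = 0%VS /\ forall d, (d < c)%N -> lcs d.+1 != 0%VS.

Definition stem : Prop := (center <= lcs 2)%VS.

Definition abelianization : Type := lquot (lcs_ideal 2).
HB.instance Definition _ := VectLieAlgebra.on abelianization.

(* L^i / L^j, as a subspace of L / L^j *)
Definition lcs_quot_vspace i j : {vspace lquot (lcs_ideal j)} :=
  (linfun (lpi (lcs_ideal j)) @: lcs i)%VS.
Definition lcs_quot i j : Type := subvs_of (lcs_quot_vspace i j).
HB.instance Definition _ i j := Vector.on (lcs_quot i j).

(* the class x + L^j, for x in L^i ([vsproj] is a junk projection otherwise) *)
Definition lcs_class i j x : lcs_quot i j :=
  vsproj (lcs_quot_vspace i j) (lpi (lcs_ideal j) x).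

Lemma lcs_classK i j x :
  x \in lcs i -> vsval (lcs_class i j x) = lpi (lcs_ideal j) x.
Proof.
move=> xi; apply: vsprojK; rewrite -[lpi _ x](lfunE (lpi (lcs_ideal j))).
exact: memv_img.
Qed.

End FinDimLie.

(** Tensor product of finite-dimensional vector spaces: [u \ox w] is the matrix
    of the products of the coordinates of [u] and [w]; [tensmod_universal] is
    the universal property. *)

Reserved Notation "u \ox w" (at level 40, left associativity).

Definition tensmod (F : fieldType) (U W : vectType F) : Type :=
  'M[F]_(\dim {:U}, \dim {:W}).
HB.instance Definition _ (F : fieldType) (U W : vectType F) :=
  Vector.on (tensmod U W).

Definition otimes (F : fieldType) (U W : vectType F) (u : U) (w : W) :
  tensmod U W :=
  \matrix_(i, j) (coord (vbasis {:U}) i u * coord (vbasis {:W}) j w).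
Notation "u \ox w" := (otimes u w) : ring_scope.

Section TensorProduct.
Variables (F : fieldType) (U W X : vectType F).

Definition bilinear_map (b : U -> W -> X) : Prop :=
  (forall w, linear (b^~ w)) /\ (forall u, linear (b u)).

Definition tlift_fun (b : U -> W -> X) (t : tensmod U W) : X :=
  \sum_i \sum_j (t : 'M[F]_(_, _)) i j
    *: b (vbasis {:U})`_i (vbasis {:W})`_j.

Fact tlift_fun_linear b : linear (tlift_fun b).
Proof.
move=> a s t; rewrite /tlift_fun scaler_sumr -big_split /=.
apply: eq_bigr => i _; rewrite scaler_sumr -big_split /=.
by apply: eq_bigr => j _; rewrite !mxE scalerDl scalerA.
Qed.
HB.instance Definition _ b :=
  GRing.isLinear.Build F (tensmod U W) X *:%R (tlift_fun b)
    (tlift_fun_linear b).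

Definition tlift (b : U -> W -> X) : 'Hom(tensmod U W, X) :=
  linfun (tlift_fun b).

Lemma linear_coord (V : vectType F) (f : V -> X) (v : V) : linear f ->
  f v = \sum_i coord (vbasis {:V}) i v *: f (vbasis {:V})`_i.
Proof.
move=> f_lin; pose g : {linear V -> X} :=
  HB.pack f (GRing.isLinear.Build F V X *:%R f f_lin).
rewrite {1}(coord_vbasis (memvf v)) -[f _]/(g _) linear_sum.
by apply: eq_bigr => i _; rewrite linearZ.
Qed.

Lemma tliftE b u w : bilinear_map b -> tlift b (u \ox w) = b u w.
Proof.
move=> [bl br]; rewrite lfunE /= /tlift_fun (linear_coord u (bl w)).
apply: eq_bigr => i _; rewrite (linear_coord w (br _)) scaler_sumr.
by apply: eq_bigr => j _; rewrite mxE scalerA.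
Qed.

Lemma tlift_param_linear (R : lmodType F) (b : U -> W -> R -> X) t :
  (forall u w, linear (b u w)) -> linear (fun r => tlift (fun u w => b u w r) t).
Proof.
move=> b_lin a r r'; rewrite !lfunE /= /tlift_fun scaler_sumr -big_split /=.
apply: eq_bigr => i _; rewrite scaler_sumr -big_split /=.
by apply: eq_bigr => j _; rewrite b_lin scalerDr !scalerA mulrC.
Qed.

Lemma otimes_linearl (w : W) : linear (fun u : U => u \ox w).
Proof.
by move=> a u u'; apply/matrixP => i j; rewrite !mxE linearP /= mulrDl mulrA.
Qed.

Lemma otimes_linearr (u : U) : linear (fun w : W => u \ox w).
Proof.
move=> a w w'; apply/matrixP => i j.
by rewrite !mxE linearP /= mulrDr mulrCA.
Qed.

Lemma otimes_hom_ext (f g : 'Hom(tensmod U W, X)) :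
  (forall u w, f (u \ox w) = g (u \ox w)) -> f = g.
Proof.
move=> fg; apply/lfunP => t.
have -> : t = \sum_i \sum_j (t : 'M[F]_(_, _)) i j
              *: ((vbasis {:U})`_i \ox (vbasis {:W})`_j).
  have fU := basis_free (vbasisP {:U}); have fW := basis_free (vbasisP {:W}).
  rewrite [LHS](matrix_sum_delta t); apply: eq_bigr => i _; apply: eq_bigr => j _.
  congr (_ *: _); apply/matrixP => k l; rewrite !mxE !coord_free //.
  by rewrite -natrM mulnb ![_ == k]eq_sym ![_ == l]eq_sym.
rewrite !linear_sum; apply: eq_bigr => i _; rewrite !linear_sum.
by apply: eq_bigr => j _; rewrite !linearZ /= fg.
Qed.

Lemma tensmod_universal b : bilinear_map b ->
  exists! f : 'Hom(tensmod U W, X), forall u w, f (u \ox w) = b u w.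
Proof.
move=> bb; exists (tlift b); split=> [u w|f fE]; first exact: tliftE.
by apply: otimes_hom_ext => u w; rewrite tliftE.
Qed.

End TensorProduct.

Section Gamma.
Variables (F : fieldType) (L : vectLieType F).
Implicit Types x y z w : L.

(* V = (L / Z(L))^(ab) *)
Definition abZ : Type := abelianization (lquot (center_ideal L)).
HB.instance Definition _ := VectLieAlgebra.on abZ.

Definition ubar x : abZ :=
  lpi (lcs_ideal (lquot (center_ideal L)) 2) (lpi (center_ideal L) x).

Fact ubar_is_linear : linear ubar.
Proof. by move=> a x y; rewrite /ubar !linearP. Qed.
HB.instance Definition _ :=
  GRing.isLinear.Build F L abZ *:%R ubar ubar_is_linear.

Definition urepr (v : abZ) : L := lrepr (lrepr v).

Lemma ureprK : cancel urepr ubar.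
Proof. by move=> v; rewrite /ubar /urepr !lreprK. Qed.

Lemma lcs2_lquot (I : lieIdeal L) x :
  lpi I x \in lcs (lquot I) 2 -> exists2 y, y \in lcs L 2 & lpi I x = lpi I y.
Proof.
pose f := linfun (lpi I).
have sub : (lcs (lquot I) 2 <= f @: lcs L 2)%VS.
  apply: liev_sub => p q _ _; rewrite -(lreprK p) -(lreprK q) -lpi_lie.
  by rewrite -[lpi I _](lfunE (lpi I)) memv_img // lcs_lie // memvf.
move=> /(subvP sub) /memv_imgP[y yL2 xy]; exists y => //.
by rewrite xy lfunE.
Qed.

(* the identification (L / Z(L))^(ab) = L / (L^2 + Z(L)) *)
Lemma ubarP x y : (ubar x = ubar y) <-> (x - y \in lcs L 2 + center L)%VS.
Proof.
rewrite /ubar lpiP; split=> [|/memv_addP[u uL2 [v vZ xy]]].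
  rewrite -linearB /= => /lcs2_lquot[u uL2 /lpiP xyu].
  by rewrite -[x - y](subrK u) addrC memv_add.
have -> : lpi (center_ideal L) x - lpi (center_ideal L) y
        = lpi (center_ideal L) u.
  by rewrite -linearB xy; apply/lpiP; rewrite addrAC subrr add0r.
pose f := linfun (lpi (center_ideal L)).
suff /subvP sub : (lcs L 2 <= f @^-1: lcs (lquot (center_ideal L)) 2)%VS.
  by have := sub _ uL2; rewrite -memv_preim lfunE.
apply: liev_sub => p q _ _; rewrite -memv_preim lfunE /= lpi_lie.
by rewrite lcs_lie // memvf.
Qed.

Lemma urepr_linear (X : lmodType F) (f : L -> X) : linear f ->
  (forall x, x \in (lcs L 2 + center L)%VS -> f x = 0) ->
  linear (f \o urepr) /\ forall x, f (urepr (ubar x)) = f x.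
Proof.
move=> f_lin f0; pose g : {linear L -> X} :=
  HB.pack f (GRing.isLinear.Build F L X *:%R f f_lin).
have fE x y : ubar x = ubar y -> f x = f y.
  move=> /ubarP/f0; rewrite -[f _]/(g _) linearB => /eqP.
  by rewrite subr_eq0 => /eqP.
split=> [a u v|x]; last by apply: fE; rewrite ureprK.
by rewrite /= -f_lin; apply: fE; rewrite ureprK linearP /= !ureprK.
Qed.

Lemma lcs_class_is_linear i j : linear (@lcs_class F L i j).
Proof. by move=> a x y; rewrite /lcs_class !linearP. Qed.
HB.instance Definition _ i j := GRing.isLinear.Build F L (lcs_quot L i j) *:%R
  (@lcs_class F L i j) (@lcs_class_is_linear i j).

Lemma lcs_class0 i j x : x \in lcs L j -> lcs_class i j x = 0.
Proof.
move=> xj; rewrite /lcs_class; have -> : lpi (lcs_ideal L j) x = 0.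
  by rewrite -(linear0 (lpi (lcs_ideal L j))); apply/lpiP; rewrite subr0.
exact: linear0.
Qed.

Lemma ubar0 x : x \in (lcs L 2 + center L)%VS -> ubar x = 0.
Proof. by move=> x0; rewrite -(linear0 ubar); apply/ubarP; rewrite subr0. Qed.

Lemma lie_lcs2Z x y : x \in (lcs L 2 + center L)%VS -> [lie x, y] \in lcs L 3.
Proof.
move=> /memv_addP[u uL2 [v /centerP vZ ->]].
by rewrite lieDl vZ addr0 lcs_lie.
Qed.

Lemma lie_lcs22Z x y :
  x \in lcs L 2 -> y \in (lcs L 2 + center L)%VS -> [lie x, y] \in lcs L 4.
Proof.
move=> xL2 /memv_addP[u uL2 [v /centerP vZ ->]].
rewrite lieDr [ [lie x, v] ]lieC vZ oppr0 addr0.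
suff /subvP/(_ _ uL2) : (lcs L 2 <= linfun (lie x) @^-1: lcs L 4)%VS.
  by rewrite -memv_preim lfunE.
apply: liev_sub => p q _ _; rewrite -memv_preim lfunE /=.
move: (lie_jacobi x p q) => /eqP; rewrite -addrA addr_eq0 => /eqP ->.
rewrite rpredN rpredD // lieC rpredN lcs_lie //.
  by rewrite lieC rpredN lcs_lie.
by rewrite lcs_lie.
Qed.

(* [gamma2_expr] and [gamma3_expr] are evaluated at arbitrary representatives in
   L of the elements of V; [gamma2E] and [gamma3E] are the defining formulas, the
   latter being well defined only when L^4 = 0. *)
Definition gamma2_expr (x y z : L) : tensmod (lcs_quot L 2 3) abZ :=
  lcs_class 2 3 [lie x, y] \ox ubar z + lcs_class 2 3 [lie z, x] \ox ubar y
    + lcs_class 2 3 [lie y, z] \ox ubar x.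

Definition gamma2 :
    'Hom(tensmod (tensmod abZ abZ) abZ, tensmod (lcs_quot L 2 3) abZ) :=
  tlift (fun t r =>
    tlift (fun p q => gamma2_expr (urepr p) (urepr q) (urepr r)) t).

Definition gamma3_expr (x y z w : L) : tensmod (subvs_of (lcs L 3)) abZ :=
  let L3 := vsproj (lcs L 3) in
  L3 [lie [lie x, y], z] \ox ubar w + L3 [lie w, [lie x, y]] \ox ubar z
    + L3 [lie [lie z, w], x] \ox ubar y + L3 [lie y, [lie z, w]] \ox ubar x.

Definition gamma3 :
    'Hom(tensmod (tensmod (tensmod abZ abZ) abZ) abZ,
         tensmod (subvs_of (lcs L 3)) abZ) :=
  tlift (fun t s =>
    tlift (fun t' r =>
      tlift (fun p q =>
        gamma3_expr (urepr p) (urepr q) (urepr r) (urepr s)) t') t).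

Definition descends (X : lmodType F) (f : L -> X) : Prop :=
  linear f /\ forall x, x \in (lcs L 2 + center L)%VS -> f x = 0.

Section Lift.
Variable X : vectType F.

Lemma lift2E (B : L -> L -> X) x y :
  (forall q, descends (B^~ q)) -> (forall p, descends (B p)) ->
  tlift (fun p q => B (urepr p) (urepr q)) (ubar x \ox ubar y) = B x y.
Proof.
move=> Bl Br; rewrite tliftE; last first.
  split=> [q|p].
    by have [lin zer] := Bl (urepr q); have [] := urepr_linear lin zer.
  by have [lin zer] := Br (urepr p); have [] := urepr_linear lin zer.
have [lin zer] := Bl (urepr (ubar y)); have [_ ->] := urepr_linear lin zer.
by have [lin' zer'] := Br x; have [_ ->] := urepr_linear lin' zer'.
Qed.

Lemma lift3E (G : L -> L -> L -> X) x y z :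
  (forall q r, descends (fun p => G p q r)) ->
  (forall p r, descends (fun q => G p q r)) ->
  (forall p q, descends (G p q)) ->
  tlift (fun t r => tlift (fun p q => G (urepr p) (urepr q) (urepr r)) t)
    (ubar x \ox ubar y \ox ubar z) = G x y z.
Proof.
move=> G1 G2 G3; rewrite tliftE; last first.
  split=> [r|t]; first exact: linearP.
  apply: (tlift_param_linear (b := fun p q r => G (urepr p) (urepr q) (urepr r))).
  move=> p q; have [lin zer] := G3 (urepr p) (urepr q).
  by have [] := urepr_linear lin zer.
rewrite (lift2E (B := fun p q => G p q (urepr (ubar z)))) //.
by have [lin zer] := G3 x y; have [_ ->] := urepr_linear lin zer.
Qed.

Lemma lift4E (G : L -> L -> L -> L -> X) x y z w :
  (forall q r s, descends (fun p => G p q r s)) ->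
  (forall p r s, descends (fun q => G p q r s)) ->
  (forall p q s, descends (fun r => G p q r s)) ->
  (forall p q r, descends (G p q r)) ->
  tlift (fun t s => tlift (fun t' r =>
      tlift (fun p q => G (urepr p) (urepr q) (urepr r) (urepr s)) t') t)
    (ubar x \ox ubar y \ox ubar z \ox ubar w) = G x y z w.
Proof.
move=> G1 G2 G3 G4; rewrite tliftE; last first.
  split=> [s|t]; first exact: linearP.
  apply: (tlift_param_linear (b := fun t' r s =>
    tlift (fun p q => G (urepr p) (urepr q) (urepr r) (urepr s)) t')).
  move=> t' r; apply: (tlift_param_linear (b := fun p q s =>
    G (urepr p) (urepr q) (urepr r) (urepr s))).
  move=> p q; have [lin zer] := G4 (urepr p) (urepr q) (urepr r).
  by have [] := urepr_linear lin zer.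
rewrite (lift3E (G := fun p q r => G p q r (urepr (ubar w)))) //.
by have [lin zer] := G4 x y z; have [_ ->] := urepr_linear lin zer.
Qed.

End Lift.

Section Otimes.
Variables (U W : vectType F).
Lemma otimesPl (w : W) a (u u' : U) :
  (a *: u + u') \ox w = a *: (u \ox w) + u' \ox w.
Proof. exact: otimes_linearl. Qed.
Lemma otimesPr (u : U) a (w w' : W) :
  u \ox (a *: w + w') = a *: (u \ox w) + u \ox w'.
Proof. exact: otimes_linearr. Qed.
Lemma otimes0l (w : W) : (0 : U) \ox w = 0.
Proof. by apply/matrixP => i j; rewrite !mxE linear0 mul0r. Qed.
Lemma otimes0r (u : U) : u \ox (0 : W) = 0.
Proof. by apply/matrixP => i j; rewrite !mxE linear0 mulr0. Qed.
End Otimes.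

Lemma scaleD3 (X : lmodType F) a (A1 A2 A3 B1 B2 B3 : X) :
  a *: (A1 + A2 + A3) + (B1 + B2 + B3)
  = a *: A1 + B1 + (a *: A2 + B2) + (a *: A3 + B3).
Proof. by rewrite !scalerDr addrACA [X in X + _]addrACA. Qed.

Lemma scaleD4 (X : lmodType F) a (A1 A2 A3 A4 B1 B2 B3 B4 : X) :
  a *: (A1 + A2 + A3 + A4) + (B1 + B2 + B3 + B4)
  = a *: A1 + B1 + (a *: A2 + B2) + (a *: A3 + B3) + (a *: A4 + B4).
Proof. by rewrite scalerDr addrACA scaleD3. Qed.

Theorem gamma2E x y z :
  gamma2 (ubar x \ox ubar y \ox ubar z) = gamma2_expr x y z.
Proof.
have P2 a (u v w : L) : [lie a *: u + v, w] = a *: [lie u, w] + [lie v, w].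
  exact: lie_linearl.
have P3 a (u v w : L) : [lie w, a *: u + v] = a *: [lie w, u] + [lie w, v].
  exact: lie_linearr.
have lZ (u v : L) : v \in (lcs L 2 + center L)%VS -> [lie u, v] \in lcs L 3.
  by move=> vZ; rewrite lieC rpredN lie_lcs2Z.
apply: lift3E => p q; split=> [a u v|u uZ]; rewrite /gamma2_expr.
all: try by rewrite scaleD3 !(P2, P3, linearP) /= !(otimesPl, otimesPr).
all: by rewrite ?(ubar0 uZ) ?(lcs_class0 _ (lie_lcs2Z _ uZ))
  ?(lcs_class0 _ (lZ _ _ uZ)) ?otimes0l ?otimes0r ?addr0.
Qed.

Theorem gamma3E x y z w : lcs L 4 = 0%VS ->
  gamma3 (ubar x \ox ubar y \ox ubar z \ox ubar w) = gamma3_expr x y z w.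
Proof.
move=> L4.
have P2 a (u v t : L) : [lie a *: u + v, t] = a *: [lie u, t] + [lie v, t].
  exact: lie_linearl.
have P3 a (u v t : L) : [lie t, a *: u + v] = a *: [lie t, u] + [lie t, v].
  exact: lie_linearr.
have L22 (p q : L) : [lie p, q] \in lcs L 2 by rewrite lcs_lie ?memvf.
have Z1 (u p q : L) : u \in (lcs L 2 + center L)%VS -> [lie [lie u, p], q] = 0.
  move=> uZ; apply/eqP; rewrite -memv0 -L4 lcs_lie //; exact: lie_lcs2Z.
have Z2 (u p q : L) : u \in (lcs L 2 + center L)%VS -> [lie [lie p, u], q] = 0.
  by move=> uZ; rewrite [ [lie p, u] ]lieC lieNl Z1 ?oppr0.
have Z3 (u p q : L) : u \in (lcs L 2 + center L)%VS -> [lie [lie p, q], u] = 0.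
  by move=> uZ; apply/eqP; rewrite -memv0 -L4 lie_lcs22Z.
have Z1' (u p q : L) : u \in (lcs L 2 + center L)%VS -> [lie q, [lie u, p]] = 0.
  by move=> uZ; rewrite lieC Z1 ?oppr0.
have Z2' (u p q : L) : u \in (lcs L 2 + center L)%VS -> [lie q, [lie p, u]] = 0.
  by move=> uZ; rewrite lieC Z2 ?oppr0.
have Z3' (u p q : L) : u \in (lcs L 2 + center L)%VS -> [lie u, [lie p, q]] = 0.
  by move=> uZ; rewrite lieC Z3 ?oppr0.
apply: lift4E => p q r; split=> [a u v|u uZ]; rewrite /gamma3_expr.
all: try by rewrite scaleD4 !(P2, P3, linearP) /=
  !(otimesPl, otimesPr).
all: by rewrite ?(ubar0 uZ) ?(Z1 _ _ _ uZ) ?(Z2 _ _ _ uZ) ?(Z3 _ _ _ uZ)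
  ?(Z1' _ _ _ uZ) ?(Z2' _ _ _ uZ) ?(Z3' _ _ _ uZ) ?linear0
  ?otimes0l ?otimes0r ?addr0.
Qed.

End Gamma.

Definition has_dim (F : fieldType) (V : lmodType F) (n : nat) : Prop :=
  inhabited (Vector.axiom n V).

(* Main.v *)
(** The Lie bracket of two wedges is a wedge, so [L /\ L] is spanned as a vector
    space by the [x /\ y]. Let [W3 <= W2] be the subspaces of [L /\ L] spanned by
    [L^3 /\ L] and [L^2 /\ L].
    - [(L /\ L) / W2] is a quotient of [L/L^2 /\ L/L^2].
    - Pushing brackets to the left by [a /\ [b, c] = [a, b] /\ c - [a, c] /\ b]
      shows that [W2 / W3] is a quotient of [L^2/L^3 (x) L^ab] and, as [L^4 = 0],
      that [W3] is a quotient of [L^3 (x) L^ab].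
    - The Jacobi identity
      [[x, y] /\ z + [z, x] /\ y + [y, z] /\ x = 0]
      says that these two quotient maps kill the images of [gamma2] and [gamma3].
    Adding up the dimensions gives the inequality. *)

From HB Require Import structures.
Require Import Defs.
From mathcomp Require Import all_boot all_order all_algebra.
From mathcomp Require Import boolp.

Set Implicit Arguments.
Unset Strict Implicit.
Unset Printing Implicit Defensive.

Import GRing.Theory.
Local Open Scope ring_scope.

(** * Vector spaces as Lie algebras with zero bracket *)

Section TrivialLie.
Variables (F : fieldType) (V : lmodType F).

(** Every subspace of [trivLie V] is an ideal, so [lquot] also yields quotients of bare vector
    spaces; as a target, it lets a universal property of Lie algebras produce a merely linear
    map. *)
Definition trivLie : Type := V.
HB.instance Definition _ := GRing.Lmodule.on trivLie.
Definition triv_lie (x y : trivLie) : trivLie := 0.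
Fact triv_liel y : linear (triv_lie^~ y).
Proof. by move=> a u v; rewrite /triv_lie scaler0 addr0. Qed.
Fact triv_lier x : linear (triv_lie x).
Proof. by move=> a u v; rewrite /triv_lie scaler0 addr0. Qed.
Fact triv_liexx x : triv_lie x x = 0.
Proof. by []. Qed.
Fact triv_jacobi x y z : triv_lie x (triv_lie y z)
  + triv_lie y (triv_lie z x) + triv_lie z (triv_lie x y) = 0.
Proof. by rewrite /triv_lie !addr0. Qed.
HB.instance Definition _ := isLieAlgebra.Build F trivLie
  triv_liel triv_lier triv_liexx triv_jacobi.

End TrivialLie.

HB.instance Definition _ (F : fieldType) (V : vectType F) :=
  Vector.on (trivLie V).

(** * Finite dimension of linear images *)

Section FinDim.
Variables (F : fieldType) (V : vectType F) (M : lmodType F).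

Section Kernel.
Variable f : {linear V -> M}.
Definition ker_pred : {pred trivLie V} := fun v => f v == 0.
Fact ker_submod : submod_closed ker_pred.
Proof.
split=> [|a u v /eqP fu /eqP fv]; first by apply/eqP; rewrite linear0.
by apply/eqP; rewrite linearP fu fv scaler0 addr0.
Qed.
Fact ker_lie x y : y \in ker_pred -> [lie x, y] \in ker_pred.
Proof. by move=> _; apply/eqP; rewrite linear0. Qed.
Definition ker_ideal := LieIdeal ker_submod ker_lie.
End Kernel.

(** [M] is isomorphic to the quotient of [V] by the kernel of [f], which is finite-dimensional. *)
Lemma surj_vect_axiom (f : {linear V -> M}) :
  (forall x, exists v, f v = x) -> {n : nat & Vector.axiom n M}.
Proof.
move=> /choice[g gK]; have [n [h h_lin h_bij]] := lquot_vect_axiom (ker_ideal f).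
exists n; exists (fun x => h (lpi (ker_ideal f) (g x))).
  (* The chosen section [g] need not be linear, but it is linear modulo the kernel of [f]. *)
  move=> a x y; rewrite -h_lin -linearP; congr h; apply/lpiP/eqP.
  by rewrite linearB linearP !gK subrr.
apply: (bij_comp h_bij); exists (fun q : lquot (ker_ideal f) => f (lrepr q)) => [x|q].
  have /eqP := lrepr_lpi (ker_ideal f) (g x).
  by rewrite linearB gK => /eqP; rewrite subr_eq0 => /eqP.
by rewrite -[RHS]lreprK; apply/lpiP/eqP; rewrite linearB gK subrr.
Qed.

End FinDim.

Lemma has_dimv (F : fieldType) (V : vectType F) : has_dim V (\dim {:V}).
Proof.
pose e := vbasis {:V}; have e_free := basis_free (vbasisP {:V}).
split; exists (fun v => \row_i coord e i v).
  by move=> a u v; apply/rowP => i; rewrite !mxE linearP.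
exists (fun r : 'rV_(\dim {:V}) => \sum_i r 0 i *: e`_i) => [v|r].
  by rewrite [RHS](coord_vbasis (memvf v)); apply: eq_bigr => i _; rewrite mxE.
by apply/rowP => i; rewrite mxE coord_sum_free.
Qed.

(** * Universal properties of free Lie algebras and of quotients by generated ideals *)

Section LieHom.
Variables (F : fieldType) (T : lieType F).

Definition lie_hom (L : lieType F) (g : L -> T) :=
  linear g /\ forall x y, g [lie x, y] = [lie g x, g y].

Section FreeLift.
Variables (X : Type) (f : X -> T).

Fixpoint lterm_eval (s : lterm F X) : T :=
  match s with
  | LGen x => f x
  | LZero => 0
  | LOpp s => - lterm_eval s
  | LAdd s t => lterm_eval s + lterm_eval t
  | LScale a s => a *: lterm_eval s
  | LLie s t => [lie lterm_eval s, lterm_eval t]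
  end.

Lemma lterm_eval_lcong s t : lcong s t -> lterm_eval s = lterm_eval t.
Proof.
elim=> //=; try by move=> *; congruence.
- by move=> *; rewrite addrA.
- by move=> *; rewrite addrC.
- by move=> *; rewrite add0r.
- by move=> *; rewrite addNr.
- by move=> *; rewrite scalerA.
- by move=> *; rewrite scale1r.
- by move=> *; rewrite scalerDr.
- by move=> *; rewrite scalerDl.
- by move=> *; rewrite lie_linearl.
- by move=> *; rewrite lie_linearr.
- by move=> *; rewrite liexx.
- by move=> *; rewrite lie_jacobi.
Qed.

Lemma freeLie_lift :
  exists2 g : freeLie F X -> T, lie_hom g & forall x, g (fl_gen F x) = f x.
Proof.
pose g (x : freeLie F X) := lterm_eval (fl_repr x).
have gE s : g (fl_pi s) = lterm_eval s by exact/lterm_eval_lcong/fl_repr_pi.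
exists g; last by move=> x; rewrite gE.
split=> [a x y|x y]; rewrite -(fl_reprK x) -(fl_reprK y).
  by rewrite /GRing.add /GRing.scale /= fl_scaleE fl_addE !gE.
by rewrite /lie /= fl_lieE !gE.
Qed.
End FreeLift.

(** The kernel of [g] is an ideal containing [A], hence it contains the ideal generated by [A]. *)
Lemma ideal_gen_lift (L : lieType F) (A : L -> Prop) (g : L -> T) :
    lie_hom g -> (forall x, A x -> g x = 0) ->
  exists2 h : lquot (ideal_gen A) -> T,
    lie_hom h & forall x, h (lpi (ideal_gen A) x) = g x.
Proof.
move=> [g_lin g_lie] gA.
pose g' : {linear L -> T} := HB.pack g (GRing.isLinear.Build F L T *:%R g g_lin).
pose K : {pred L} := fun x => g' x == 0.
have K_submod : submod_closed K.
  split=> [|a u v /eqP gu /eqP gv]; first by apply/eqP; rewrite linear0.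
  by apply/eqP; rewrite linearP gu gv scaler0 addr0.
have K_lie x y : y \in K -> [lie x, y] \in K.
  by move=> /eqP gy; apply/eqP; rewrite [LHS]g_lie [g y]gy lie0r.
have gI x : x \in ideal_pred (ideal_gen A) -> g x = 0.
  move=> /asboolP/(_ (LieIdeal K_submod K_lie))xK; apply/eqP/xK => y /gA gy.
  exact/eqP.
have hE x : g (lrepr (lpi (ideal_gen A) x)) = g x.
  have /gI/eqP := lrepr_lpi (ideal_gen A) x.
  by rewrite -[g _]/(g' _) linearB subr_eq0 => /eqP.
exists (fun q => g (lrepr q)) => //.
split=> [a x y|x y]; rewrite -(lreprK x) -(lreprK y).
  by rewrite -linearP !hE g_lin.
by rewrite -lpi_lie !hE g_lie.
Qed.

End LieHom.

(** * Identities, spanning set and universal property of the exterior square *)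

Section ExteriorSquare.
Variables (F : fieldType) (L : lieType F).
Implicit Types m n : L.

Lemma mem_ideal_gen (M : lieType F) (A : M -> Prop) x :
  A x -> x \in ideal_pred (ideal_gen A).
Proof. by move=> Ax; apply/asboolP => I; apply. Qed.

Let rel_eq u v : tensorsq_rel (u - v) ->
  lpi (ideal_gen (@tensorsq_rel F L)) u = lpi (ideal_gen (@tensorsq_rel F L)) v.
Proof. by move=> uv; apply/lpiP/mem_ideal_gen. Qed.

Lemma wedge_linearr m : linear (wedge m).
Proof.
move=> a n n'; rewrite /wedge -linearP; congr lpi.
by rewrite /tens -linearP; apply/rel_eq/tr_linearr.
Qed.
Lemma wedge_linearl n : linear (@wedge F L ^~ n).
Proof.
move=> a m m'; rewrite /wedge -linearP; congr lpi.
by rewrite /tens -linearP; apply/rel_eq/tr_linearl.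
Qed.
HB.instance Definition _ m :=
  GRing.isLinear.Build F L (extsq L) *:%R (wedge m) (wedge_linearr m).

Lemma wedgexx m : wedge m m = 0.
Proof.
rewrite -(linear0 (lpi (ideal_gen (@extsq_rel F L)))).
by apply/lpiP/mem_ideal_gen; exists m; rewrite subr0.
Qed.
Lemma wedgeC m n : wedge m n = - wedge n m.
Proof.
apply/eqP; rewrite -addr_eq0; apply/eqP.
have := wedgexx (m + n); have := wedge_linearl (m + n) 1 m n.
by rewrite !scale1r => ->; rewrite !linearD /= !wedgexx add0r addr0.
Qed.
Lemma wedge_liel m m' n :
  wedge [lie m, m'] n = wedge m [lie m', n] - wedge m' [lie m, n].
Proof.
rewrite /wedge -linearB; congr lpi.
by rewrite /tens -linearB; apply/rel_eq/tr_liel.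
Qed.
Lemma wedge_lie m n m' n' :
  [lie wedge m n, wedge m' n'] = - wedge [lie n, m] [lie m', n'].
Proof.
rewrite /wedge -lpi_lie -linearN; congr lpi.
by rewrite /tens -lpi_lie -linearN; apply/rel_eq/tr_lie.
Qed.

(** Wedges span linearly because the bracket of two wedges is again a wedge up to sign. The
    induction runs over formal Lie terms, with [P] generalised so that it can change in the bracket
    case. *)
Lemma extsq_ind (P : extsq L -> Prop) :
    P 0 -> (forall a x y, P x -> P y -> P (a *: x + y)) ->
    (forall m n, P (wedge m n)) ->
  forall x, P x.
Proof.
move=> P0 PP Pw x; rewrite -(lreprK x) -(lreprK (lrepr x)).
rewrite -(fl_reprK (lrepr (lrepr x))); move: (fl_repr _) => s {x}.
pose E s : extsq L := lpi _ (lpi _ (fl_pi s)).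
rewrite -[lpi _ _]/(E s); elim: s P P0 PP Pw => [[m n]||s IHs|s IHs t IHt
  |a s IHs|s IHs t IHt] P P0 PP Pw.
- exact: Pw.
- have -> : E LZero = 0 by rewrite /E -[fl_pi LZero]/(0 : freeLie _ _) !linear0.
  exact: P0.
- have -> : E (LOpp s) = - 1 *: E s + 0.
    by rewrite scaleN1r addr0 /E -!linearN -fl_oppE.
  by apply: (PP) => //; apply: (IHs P).
- have -> : E (LAdd s t) = 1 *: E s + E t.
    by rewrite scale1r /E -!linearD -fl_addE.
  by apply: (PP); [apply: (IHs P) | apply: (IHt P)].
- have -> : E (LScale a s) = a *: E s + 0.
    by rewrite addr0 /E -!linearZ -fl_scaleE.
  by apply: (PP) => //; apply: (IHs P).
have -> : E (LLie s t) = [lie E s, E t] by rewrite /E -!lpi_lie -fl_lieE.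
(* Bilinearity reduces first the left factor, then the right one, to a single wedge. *)
apply: (IHs (fun x => P [lie x, E t])) => [|a x y Px Py|m n].
- by rewrite lie0l.
- by rewrite lie_linearl; apply: PP.
apply: (IHt (fun y => P [lie wedge m n, y])) => [|a x y Px Py|m' n'].
- by rewrite lie0r.
- by rewrite lie_linearr; apply: PP.
by rewrite wedge_lie -scaleN1r -[_ *: _]addr0; apply: PP.
Qed.

(** The relation for a bracket in the second argument follows from the one in the first, since [b]
    is alternating and so antisymmetric. *)
Lemma extsq_lift (T : lieType F) (b : L -> L -> T) :
    (forall n, linear (b^~ n)) -> (forall m, linear (b m)) ->
    (forall m, b m m = 0) ->
    (forall m m' n, b [lie m, m'] n = b m [lie m', n] - b m' [lie m, n]) ->
    (forall m n m' n', [lie b m n, b m' n'] = - b [lie n, m] [lie m', n']) ->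
  exists2 g : extsq L -> T, lie_hom g & forall m n, g (wedge m n) = b m n.
Proof.
move=> bl br bxx b_liel b_lie.
have bC m n : b m n = - b n m.
  apply/eqP; rewrite -addr_eq0; apply/eqP; have := bxx (m + n).
  have := bl (m + n) 1 m n; rewrite !scale1r => ->.
  have := br m 1 m n; have := br n 1 m n; rewrite !scale1r => -> ->.
  by rewrite !bxx add0r addr0.
have [g0 g0_hom g0E] := freeLie_lift (fun p : L * L => b p.1 p.2).
have [g0_lin g0_lie] := g0_hom.
pose g0' : {linear freeLie F (L * L) -> T} :=
  HB.pack g0 (GRing.isLinear.Build F _ T *:%R g0 g0_lin).
have g0D x y : g0 (x - y) = g0 x - g0 y by exact: (linearB g0').
have g0N x : g0 (- x) = - g0 x by exact: (linearN g0').
have [x relx|g1 g1_hom g1E] := ideal_gen_lift (A := @tensorsq_rel F L) g0_hom.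
  have b_lier m n n' : b m [lie n, n'] = b [lie n', m] n - b [lie n, m] n'.
    by rewrite bC b_liel opprB addrC [in RHS]bC [b [lie n, m] _]bC opprK.
  case: relx => *; rewrite g0D ?g0D ?g0N ?g0_lin ?g0_lie ?g0E /=; apply/eqP;
    rewrite subr_eq0; apply/eqP.
  - exact: bl.
  - exact: br.
  - exact: b_liel.
  - exact: b_lier.
  - exact: b_lie.
have [x [m ->]|g g_hom gE] := ideal_gen_lift (A := @extsq_rel F L) g1_hom.
  by rewrite g1E g0E /= bxx.
by exists g => // m n; rewrite gE g1E g0E.
Qed.

End ExteriorSquare.

Lemma wedgeBl (F : fieldType) (L : lieType F) (x y z : L) :
  wedge (x - y) z = wedge x z - wedge y z.
Proof. by rewrite addrC -scaleN1r wedge_linearl scaleN1r addrC. Qed.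

(** This is the defining relation for a bracket in the first argument, rearranged by
    antisymmetry. *)
Lemma wedge_jacobi (F : fieldType) (L : lieType F) (x y z : L) :
  wedge [lie x, y] z + wedge [lie z, x] y + wedge [lie y, z] x = 0.
Proof.
rewrite wedge_liel (wedgeC x).
have -> : wedge y [lie x, z] = wedge [lie z, x] y.
  by rewrite [ [lie x, z] ]lieC linearN -wedgeC.
by rewrite subrK addNr.
Qed.

(** * Finite dimension of the exterior square *)

Section ExteriorSquareVect.
Variables (F : fieldType) (L : vectLieType F).

Definition wedge_comb (A : 'M[F]_(\dim {:L})) : extsq L :=
  \sum_i \sum_j A i j *: wedge (vbasis {:L})`_i (vbasis {:L})`_j.

Fact wedge_comb_linear : linear wedge_comb.
Proof.
move=> a A B; rewrite /wedge_comb scaler_sumr -big_split /=.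
apply: eq_bigr => i _; rewrite scaler_sumr -big_split /=.
by apply: eq_bigr => j _; rewrite !mxE scalerDl scalerA.
Qed.
HB.instance Definition _ := GRing.isLinear.Build F 'M[F]_(\dim {:L}) (extsq L)
  *:%R wedge_comb wedge_comb_linear.

Lemma wedge_comb_surj x : exists A, wedge_comb A = x.
Proof.
elim/extsq_ind: x => [|a _ _ [A <-] [B <-]|m n]; first by exists 0; rewrite linear0.
  by exists (a *: A + B); rewrite linearP.
exists (\matrix_(i, j) (coord (vbasis {:L}) i m * coord (vbasis {:L}) j n)).
(* [wedgeC] moves the first argument into the slot that is registered as linear. *)
rewrite [in RHS](coord_vbasis (memvf m)) wedgeC linear_sum -sumrN.
apply: eq_bigr => i _; rewrite linearZ -scalerN -wedgeC /=.
rewrite [in RHS](coord_vbasis (memvf n)) linear_sum scaler_sumr.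
by apply: eq_bigr => j _; rewrite linearZ mxE scalerA.
Qed.

HB.instance Definition _ := Lmodule_hasFinDim.Build F (extsq L)
  (projT2 (surj_vect_axiom wedge_comb_surj)).

End ExteriorSquareVect.

(** * Linear algebra for the dimension count *)

Lemma tens_ind (F : fieldType) (U W : vectType F) (P : tensmod U W -> Prop) :
    P 0 -> (forall a s t, P s -> P t -> P (a *: s + t)) ->
    (forall u w, P (u \ox w)) ->
  forall t, P t.
Proof.
move=> P0 PP Pt t; have PD s s' : P s -> P s' -> P (s + s').
  by move=> Ps Ps'; rewrite -[s]scale1r; apply: (PP).
have PZ a s : P s -> P (a *: s) by move=> Ps; rewrite -[_ *: _]addr0; apply: (PP).
(* Lifting [\ox] itself gives the identity, which writes [t] as a combination of pure tensors. *)
have <- : tlift (@otimes F U W) t = t.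
  rewrite -[RHS]id_lfunE; congr (fun_of_lfun _ t); apply: otimes_hom_ext => u w.
  rewrite id_lfunE tliftE //.
  by split=> [v|v]; [apply: otimes_linearl | apply: otimes_linearr].
rewrite lfunE; apply: big_ind => // i _; apply: big_ind => // j _.
by apply: PZ.
Qed.

Section Defect.
Variables (F : fieldType) (V : vectType F) (U : {vspace V}).

Definition defect : 'End(V) := (\1 - projv U)%VF.

Lemma defect0 x : x \in U -> defect x = 0.
Proof. by move=> xU; rewrite add_lfunE opp_lfunE id_lfunE projv_id // subrr. Qed.

Lemma defectK x : x - defect x \in U.
Proof. by rewrite add_lfunE opp_lfunE id_lfunE opprB addrC subrK memv_proj. Qed.

End Defect.

Lemma leq_dim_limg (F : fieldType) (U V : vectType F) (f : 'Hom(U, V)) :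
  (\dim (limg f) <= \dim {:U})%N.
Proof. by rewrite -(limg_ker_dim f fullv) leq_addl. Qed.

(** Rank-nullity for [h], whose kernel contains the image of [f]. *)
Lemma leq_dim_limg_comp0 (F : fieldType) (U V W : vectType F)
    (f : 'Hom(U, V)) (h : 'Hom(V, W)) :
  (forall t, h (f t) = 0) -> (\dim (limg h) + \dim (limg f) <= \dim {:V})%N.
Proof.
move=> hf; rewrite -(limg_ker_dim h fullv) capfv addnC leq_add2r dimvS //.
by apply/subvP => _ /memv_imgP[t _ ->]; rewrite memv_ker hf.
Qed.

(* [theta3] and [theta2] below are the surjections [L^3 (x) V -> W3] and
   [L^2/L^3 (x) V -> W2 / W3]; quotients of [extsq L] by a subspace [U] are realised
   inside [extsq L] by the endomorphism [defect U], whose kernel is [U]. *)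
Section Bound.
Variables (F : fieldType) (L : vectLieType F).
Implicit Types u x y z w : L.

(** L/L^2 maps onto L/(L^2 + Z(L)). *)
Lemma dim_abZ : (\dim {:abZ L} <= \dim {:abelianization L})%N.
Proof.
pose g (a : abelianization L) := ubar (lrepr a).
have gE x : g (lpi (lcs_ideal L 2) x) = ubar x.
  apply/ubarP; apply: subvP (addvSl _ _) _ _; exact: lrepr_lpi.
have g_lin : linear g.
  by move=> a p q; rewrite -(lreprK p) -(lreprK q) -linearP !gE linearP.
pose g' : {linear abelianization L -> abZ L} :=
  HB.pack g (GRing.isLinear.Build F _ (abZ L) *:%R g g_lin).
have <- : limg (linfun g') = fullv.
  apply/vspaceP => v; rewrite memvf -(ureprK v) -gE -[g _]/(g' _) -lfunE.
  by rewrite memv_img ?memvf.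
exact: leq_dim_limg.
Qed.

(** * The filtration of the exterior square by [W3] and [W2] *)

Lemma lie_lcs2l x y : [lie x, y] \in lcs L 2.
Proof. by rewrite lcs_lie ?memvf. Qed.

Hypotheses (L4 : lcs L 4 = 0%VS) (L_stem : stem L).

Let lcs2Z : (lcs L 2 + center L)%VS = lcs L 2.
Proof. exact/addv_idPl. Qed.

(** For y = [a, b], u /\ y = b /\ [a, u] - a /\ [b, u], and both brackets lie in L^(k+1). This makes
    the second argument of a wedge descend to V: for k = 3 with [P] zero, for k = 2 with [P] equal
    to [W3]. *)
Lemma wedge_lcs2 (P : {vspace extsq L}) k u y : (0 < k)%N ->
    (forall v w, v \in lcs L k.+1 -> wedge v w \in P) ->
  u \in lcs L k -> y \in lcs L 2 -> wedge u y \in P.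
Proof.
move=> k0 wP uk; suff /subvP sub : (lcs L 2 <= linfun (wedge u) @^-1: P)%VS.
  by move=> /sub; rewrite -memv_preim lfunE.
apply: liev_sub => a b _ _; rewrite -memv_preim lfunE /= wedgeC wedge_liel rpredN.
by rewrite rpredB // wedgeC rpredN wP // lieC rpredN lcs_lie.
Qed.

Definition theta3 : 'Hom(tensmod (subvs_of (lcs L 3)) (abZ L), extsq L) :=
  tlift (fun (u : subvs_of (lcs L 3)) v => wedge (vsval u) (urepr v)).

Lemma theta3E u y : u \in lcs L 3 ->
  theta3 (vsproj (lcs L 3) u \ox ubar y) = wedge u y.
Proof.
have wedge_descends v : v \in lcs L 3 ->
    linear (wedge v \o @urepr F L) /\ forall x, wedge v (urepr (ubar x)) = wedge v x.
  move=> v3; apply: urepr_linear => [|x]; first exact: linearP.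
  (* Stemness reduces L^2 + Z(L) to L^2; the wedges with an entry in L^4 = 0 vanish. *)
  rewrite lcs2Z => x2; apply/eqP; rewrite -memv0.
  apply: (wedge_lcs2 _ _ v3) => // t t'; rewrite L4 memv0 => /eqP ->.
  by rewrite wedgeC linear0 oppr0 mem0v.
move=> u3; rewrite tliftE ?vsprojK //; first by have [] := wedge_descends u u3.
split=> [v a p q|p]; first by rewrite linearP /= wedge_linearl.
by have [] := wedge_descends _ (subvsP p).
Qed.

Let W3 := limg theta3.

Lemma wedge_W3 u y : u \in lcs L 3 -> wedge u y \in W3.
Proof. by move=> u3; rewrite -theta3E // memv_img ?memvf. Qed.

Let d3 : 'End(extsq L) := defect W3.

Definition theta2 : 'Hom(tensmod (lcs_quot L 2 3) (abZ L), extsq L) :=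
  tlift (fun (q : lcs_quot L 2 3) v => d3 (wedge (lrepr (vsval q)) (urepr v))).

Lemma theta2E u y : u \in lcs L 2 ->
  theta2 (lcs_class 2 3 u \ox ubar y) = d3 (wedge u y).
Proof.
have d3_lpi x x' z : lpi (lcs_ideal L 3) x = lpi (lcs_ideal L 3) x' ->
    d3 (wedge x z) = d3 (wedge x' z).
  move=> /lpiP /(wedge_W3 z) xx'; apply/eqP.
  by rewrite -subr_eq0 -(linearB d3) -wedgeBl; apply/eqP/defect0.
have d3_descends v : v \in lcs L 2 ->
    linear ((fun y => d3 (wedge v y)) \o @urepr F L) /\
    forall x, d3 (wedge v (urepr (ubar x))) = d3 (wedge v x).
  move=> v2; apply: (urepr_linear (f := fun y => d3 (wedge v y))) => [a x x'|x].
    by rewrite !linearP.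
  rewrite lcs2Z => x2; apply: defect0.
  by apply: (wedge_lcs2 _ _ v2) => // t t'; apply: wedge_W3.
(* A representative modulo L^3 of a class coming from L^2 stays in L^2, because L^3 lies in L^2. *)
have repr2 (q : lcs_quot L 2 3) : lrepr (vsval q) \in lcs L 2.
  have /memv_imgP[v v2] := subvsP q; rewrite lfunE /= => qv.
  rewrite -[lrepr _](subrK v) rpredD //; apply: subvP (lcsS _ _) _ _.
  by rewrite qv; apply: lrepr_lpi.
move=> u2; rewrite tliftE.
  have [_ ->] := d3_descends _ (repr2 (lcs_class 2 3 u)).
  by apply: d3_lpi; rewrite lreprK lcs_classK.
split=> [v a p q|p]; last by have [] := d3_descends _ (repr2 p).
rewrite -(linearP d3) -wedge_linearl. apply: d3_lpi. 
rewrite lreprK [RHS]linearP /= !lreprK; exact: (linearP vsval).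
Qed.

Let W2 := (limg theta2 + W3)%VS.

Lemma wedge_W2 u y : u \in lcs L 2 -> wedge u y \in W2.
Proof.
move=> u2; rewrite -[wedge u y](subrK (d3 (wedge u y))) addrC.
by rewrite memv_add ?defectK // -theta2E // memv_img ?memvf.
Qed.

(** Modulo [W2] a wedge depends only on the classes of its arguments modulo L^2, so it factors
    through the exterior square of L/L^2; the image of the factored map and [W2] together span L /\
    L. *)
Lemma dim_extsq_ab :
  (\dim {:extsq L} <= \dim {:extsq (abelianization L)} + \dim W2)%N.
Proof.
pose A := abelianization L; pose d : 'End(extsq L) := defect W2.
pose b (p q : A) : trivLie (extsq L) := d (wedge (lrepr p) (lrepr q)).
have bE x y : b (lpi _ x) (lpi _ y) = d (wedge x y).
  rewrite /b; set x' := lrepr _; set y' := lrepr _; apply/eqP.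
  rewrite -subr_eq0 -(linearB d).
  (* Both differences are placed in the first argument, where membership in L^2 gives a wedge in
     [W2]. *)
  have -> : wedge x' y' - wedge x y = wedge (x' - x) y' - wedge (y' - y) x.
    by rewrite !wedgeBl [wedge y' x]wedgeC [wedge y x]wedgeC opprB addrA
      opprK addrAC subrK.
  by apply/eqP/defect0; rewrite rpredB // wedge_W2 // lrepr_lpi.
have lieA (p q : A) : [lie p, q] = 0.
  rewrite -(lreprK p) -(lreprK q) -lpi_lie -(linear0 (lpi _)); apply/lpiP.
  by rewrite subr0; apply: lie_lcs2l.
have br p : linear (b p).
  move=> a q q'; rewrite -(lreprK p) -(lreprK q) -(lreprK q') -linearP !bE.
  by rewrite !linearP.
have bl q : linear (b^~ q).
  move=> a p p'; rewrite -(lreprK p) -(lreprK q) -(lreprK p') -linearP !bE.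
  by rewrite wedge_linearl linearP.
have bxx p : b p p = 0 by rewrite /b wedgexx linear0.
have b0r p : b p 0 = 0.
  by have := br p (-1) 0 0; rewrite scaler0 addr0 scaleN1r addNr.
have b0l p : b 0 p = 0.
  by have := bl p (-1) 0 0; rewrite scaler0 addr0 scaleN1r addNr.
(* Brackets vanish in [A] and in the target, so both bracket conditions only say that [b] vanishes
   at 0. *)
have [||g [g_lin _] gE] := extsq_lift bl br bxx.
- by move=> m m' n; rewrite !lieA b0l !b0r subr0.
- by move=> m n m' n'; rewrite !lieA b0l oppr0.
pose g' : {linear extsq A -> extsq L} :=
  HB.pack g (GRing.isLinear.Build F (extsq A) (extsq L) *:%R g g_lin).
have sub : (fullv <= limg (linfun g') + W2)%VS.
  apply/subvP => x _; elim/extsq_ind: x => [|a x y x2 y2|m n].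
  - exact: mem0v.
  - by rewrite rpredD ?rpredZ.
  rewrite -[wedge m n](subrK (d (wedge m n))) addrC memv_add ?defectK //.
  by rewrite -bE -gE -[g _]/(g' _) -(lfunE g') memv_img ?memvf.
apply: leq_trans (dimvS sub) _; apply: leq_trans (dimv_add_leqif _ _) _.
by rewrite leq_add2r leq_dim_limg.
Qed.

(** On pure tensors the value is [d3] applied to the left side of [wedge_jacobi]. *)
Lemma theta2_gamma2 t : theta2 (gamma2 L t) = 0.
Proof.
elim/tens_ind: t => [|a s t IHs IHt|t w]; first by rewrite !linear0.
  by rewrite (linearP (gamma2 L)) (linearP theta2) /= IHs IHt scaler0 addr0.
elim/tens_ind: t => [|a s t IHs IHt|p q]; first by rewrite otimes0l !linear0.
  by rewrite otimesPl (linearP (gamma2 L)) (linearP theta2) /= IHs IHt scaler0 addr0.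
rewrite -(ureprK p) -(ureprK q) -(ureprK w) gamma2E /gamma2_expr.
by rewrite !linearD /= !theta2E ?lie_lcs2l // -!linearD wedge_jacobi linear0.
Qed.

(* With [p = [x, y]] and [q = [z, w]] this is the sum of the Jacobi identities
   for [p /\ z /\ w] and [q /\ x /\ y], since [p /\ q + q /\ p = 0]. *)
Lemma theta3_gamma3 t : theta3 (gamma3 L t) = 0.
Proof.
elim/tens_ind: t => [|a s t IHs IHt|t w]; first by rewrite !linear0.
  by rewrite (linearP (gamma3 L)) (linearP theta3) /= IHs IHt scaler0 addr0.
elim/tens_ind: t => [|a s t IHs IHt|t z]; first by rewrite otimes0l !linear0.
  by rewrite otimesPl (linearP (gamma3 L)) (linearP theta3) /= IHs IHt scaler0 addr0.
elim/tens_ind: t => [|a s t IHs IHt|x y].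
- by rewrite !otimes0l !linear0.
- by rewrite !otimesPl (linearP (gamma3 L)) (linearP theta3) /= IHs IHt scaler0 addr0.
rewrite -(ureprK x) -(ureprK y) -(ureprK z) -(ureprK w) gamma3E // /gamma3_expr.
move: (urepr x) (urepr y) (urepr z) (urepr w) => {}x {}y {}z {}w.
have lie3 u v t : [lie [lie u, v], t] \in lcs L 3 by rewrite lcs_lie ?lie_lcs2l.
have lie3r u v t : [lie t, [lie u, v]] \in lcs L 3 by rewrite lieC rpredN lie3.
rewrite !linearD /= !theta3E ?lie3 ?lie3r //.
set p := [lie x, y]; set q := [lie z, w].
have := wedge_jacobi p z w; have := wedge_jacobi q x y.
rewrite -/p -/q => /eqP; rewrite addr_eq0 => /eqP qE /eqP.
rewrite addr_eq0 => /eqP pE.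
by rewrite -addrA qE pE [wedge p q]wedgeC opprK addNr.
Qed.

(** * Adding up the dimensions *)

Lemma dim_tensmod_abZ (U : vectType F) :
  (\dim {:tensmod U (abZ L)} <= \dim {:tensmod U (abelianization L)})%N.
Proof. by rewrite !dimvf /dim /= leq_mul ?dim_abZ. Qed.

Lemma dim_extsq_bound :
  (\dim {:extsq L} + \dim (limg (gamma2 L)) + \dim (limg (gamma3 L))
   <= \dim {:extsq (abelianization L)}
      + \dim {: tensmod (lcs_quot L 2 3) (abelianization L)}
      + \dim {: tensmod (subvs_of (lcs L 3)) (abelianization L)})%N.
Proof.
have dimW2 : (\dim W2 <= \dim (limg theta2) + \dim W3)%N := dimv_add_leqif _ _.
have dim2 := leq_trans (leq_dim_limg_comp0 theta2_gamma2) (dim_tensmod_abZ _).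
have dim3 := leq_trans (leq_dim_limg_comp0 theta3_gamma3) (dim_tensmod_abZ _).
apply: leq_trans (leq_add (leq_add (leqnn _) dim2) dim3).
(* The ranks of [gamma3] and [gamma2] cancel, leaving the ranks of [theta2] and [theta3] to bound
   the dimension of [W2]. *)
rewrite [in leqRHS]addnA addnA leq_add2r addnAC leq_add2r -addnA.
apply: leq_trans dim_extsq_ab _.
by rewrite leq_add2l.
Qed.

End Bound.

Theorem theorem2p8 (F : fieldType) (L : vectLieType F)
    (hclass : nilpotent_of_class L 3) (hstem : stem L) :
  exists n m : nat,
    [/\ has_dim (extsq L) n,
        has_dim (extsq (abelianization L)) m &
        (n + \dim (limg (gamma2 L)) + \dim (limg (gamma3 L))
         <= m + \dim {: tensmod (lcs_quot L 2 3) (abelianization L)}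
              + \dim {: tensmod (subvs_of (lcs L 3)) (abelianization L)})%N].
Proof.
exists (\dim {:extsq L}), (\dim {:extsq (abelianization L)}).
split; [exact: has_dimv | exact: has_dimv |].
by apply: dim_extsq_bound hstem; case: hclass.
Qed.
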